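(* Let $I\subseteq P=\Bbbk[x_1,\dots,x_n]$ be a monomial ideal with $\dim P/I=D$. Then the following six statements are equivalent. (i) $I$ is quasi-stable. (ii) The variable $x_1$ is not a zero divisor for $P/I^{\mathrm{sat}}$, and for all $1\le j<D$ the variable $x_{j+1}$ is not a zero divisor for $P/\langle I,x_1,\dots,x_j\rangle^{\mathrm{sat}}$. (iii) We have $I:x_1^\infty\subseteq I:x_2^\infty\subseteq\cdots\subseteq I:x_D^\infty$, and for all $D<j\le n$ an exponent $k_j\ge1$ exists such that $x_j^{k_j}\in I$. (iv) For all $1\le j\le n$ the equality $I:x_j^\infty=I:\langle x_j,\dots,x_n\rangle^\infty$ holds. (v) For every associated prime ideal $\mathfrak{p}\in\mathrm{Ass}(P/I)$ an integer $1\le j\le n$ exists such that $\mathfrak{p}=\langle x_j,\dots,x_n\rangle$. (vi) If $x^\mu\in I$ and $\mu_i>0$ for some $1\le i<n$, then for each $0<r\le\mu_i$ and each $i<j\le n$ an integer $s\ge0$ exists such that $x^{\mu-r_i+s_j}\in I$.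
   Context: $\Bbbk$ is a field. The class of $\mu\in\mathbb{N}_0^n$ is $\mathrm{cls}\,\mu=\min\{i\mid\mu_i\ne0\}$, with $\mathrm{cls}\,0=n$; the Pommaret cone of $\mu$ is $C_P(\mu)=\{\mu+\rho\mid\rho\in\mathbb{N}_0^n,\ \rho_j=0\text{ for all }j>\mathrm{cls}\,\mu\}$. A monomial ideal $I$ is quasi-stable if it possesses a finite Pommaret basis, i.e. if there is a finite set $H$ of monomials in $I$ such that $\{\mu\mid x^\mu\in I\}$ is the disjoint union of the cones $C_P(\mu)$ with $x^\mu\in H$. For an integer $\ell$, $\ell_i$ denotes the multi index whose $i$th entry is $\ell$ and all of whose other entries are $0$ (this is the meaning of $r_i$ and $s_j$ in (vi)). For ideals $J,K$, $J:K^\infty=\{f\in P\mid fK^m\subseteq J\text{ for some }m\ge0\}$ and $J:x_j^\infty=J:\langle x_j\rangle^\infty$. The saturation of a homogeneous ideal $J$ is $J^{\mathrm{sat}}=\{f\in P\mid\exists k\in\mathbb{N}_0:\ f\cdot P_k\subset J\}$, where $P_k$ is the space of homogeneous polynomials of degree $k$.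
   Formalization: For I = 0 statement (v) fails (Ass(P/I) = {⟨0⟩}) while (i)–(iv) and (vi) hold, so the equivalence of all six is stated for I ≠ 0, and that of (i), (ii), (iii), (iv), (vi) for every monomial ideal I, with n ≥ 1. *)

(* Defs.v *)
From HB Require Import structures.
From mathcomp Require Import all_boot all_order all_algebra.
From mathcomp Require Export boolp classical_sets cardinality mpoly.

Set Implicit Arguments.
Unset Strict Implicit.
Unset Printing Implicit Defensive.

Import Order.TTheory GRing.Theory Num.Theory.

Local Open Scope classical_set_scope.
Local Open Scope ring_scope.

Section Ideals.
Variable R : comNzRingType.
Implicit Types (I J K S p : set R).

(* The unit ideal is allowed. *)
Definition ideal J : Prop :=
  [/\ J 0,
      forall f g, J f -> J g -> J (f + g)
    & forall f g, J g -> J (f * g)].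

Definition ideal_gen S : set R := smallest ideal S.

Fixpoint ideal_pow K (m : nat) : set R :=
  if m is m'.+1 then ideal_gen [set f * g | f in K & g in ideal_pow K m']
  else setT.

(* J : K^oo *)
Definition colon_inf J K : set R :=
  [set f | exists m, [set f * g | g in ideal_pow K m] `<=` J].

Definition prime_ideal p : Prop :=
  [/\ ideal p, ~ p 1 & forall f g, p (f * g) -> p f \/ p g].

(* Ass(R/I): the prime ideals that are the annihilator of the class of some f
   in R/I. *)
Definition associated_prime I p : Prop :=
  prime_ideal p /\ exists f, p = [set g | I (g * f)].

(* x is not a zero divisor for the module R/J; this holds when R/J = 0. *)
Definition nonzerodivisor_quot J (x : R) : Prop :=
  forall f, J (x * f) -> J f.

(* c 0 < ... < c m are the preimages in R of a chain of m + 1 primes of R/I. *)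
Definition prime_chain I (m : nat) (c : nat -> set R) : Prop :=
  (forall i, (i <= m)%N -> prime_ideal (c i) /\ I `<=` c i) /\
  (forall i, (i < m)%N -> c i `<` c i.+1).

Definition chains_bounded I (D : int) : Prop :=
  forall m c, prime_chain I m c -> m%:Z <= D.

(* D is the Krull dimension of R/I, the zero ring having dimension -1. *)
Definition krull_dim_quot I (D : int) : Prop :=
  [/\ -1 <= D, chains_bounded I D
    & forall E : int, -1 <= E -> chains_bounded I E -> D <= E].

End Ideals.

(* In {mpoly k[n]} the variable x_i, 1 <= i <= n, is 'X_j for the j : 'I_n with
   i = j.+1; likewise for the entries of multi-indices. *)
Section Polynomials.
Variables (k : fieldType) (n : nat).
Implicit Types (I J : set {mpoly k[n]}) (mu : 'X_{1..n}).

Definition monomial_ideal I : Prop :=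
  exists M : set 'X_{1..n}, I = ideal_gen [set 'X_[mu] | mu in M].

(* J^sat for a homogeneous ideal J. *)
Definition saturation J : set {mpoly k[n]} :=
  [set f | exists d : nat, forall g, g \is d.-homog -> J (f * g)].

(* < x_(j+1), ..., x_n > *)
Definition vars_from (j : 'I_n) : set {mpoly k[n]} :=
  ideal_gen [set 'X_l | l in [set l : 'I_n | (j <= l)%N]].

(* < I, x_1, ..., x_j > *)
Definition add_vars I (j : nat) : set {mpoly k[n]} :=
  ideal_gen (I `|` [set 'X_l | l in [set l : 'I_n | (l < j)%N]]).

(* The class, with values in {1, ..., n}; cls 0 = n. *)
Definition cls mu : nat := \big[minn/n]_(i < n | mu i != 0%N) i.+1.

Definition pommaret_cone mu : set 'X_{1..n} :=
  [set (mu + rho)%MM | rho in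
    [set rho : 'X_{1..n} | forall j : 'I_n, (cls mu < j.+1)%N -> rho j = 0%N]].

Definition pommaret_basis I (H : set 'X_{1..n}) : Prop :=
  [/\ forall mu, H mu -> I 'X_[mu],
      [set mu | I 'X_[mu]] = \bigcup_(mu in H) pommaret_cone mu
    & trivIset H pommaret_cone].

Definition quasi_stable I : Prop :=
  exists2 H, finite_set H & pommaret_basis I H.

End Polynomials.

(* Main.v *)
Require Import Defs.
From HB Require Import structures.
From mathcomp Require Import all_boot all_order all_algebra.
From mathcomp Require Import zify ring.
Import Order.TTheory GRing.Theory Num.Theory.
Local Open Scope classical_set_scope.
Local Open Scope ring_scope.

(* Write [A] for the set of exponents of the monomials in [I] and [A_l] for the
   set of exponents of the monomials in [I : x_l^oo]. Each of the six
   conditions says that [A_i] is contained in [A_j] whenever [i < j].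

   (i): for a large power of [x_j], the cone containing [x^mu x_j^t] has a vertex
   of class at least [j], so it does not involve the earlier variables. Conversely
   the [x^h] in [I] such that [x^h / x_c], [c] the class of [h], is not in [I]
   form a Pommaret basis; it is finite by Dickson's lemma and the stability of [A].

   (ii), (iii): here only [A_i] for [i < D] are compared. If [x_l] with [l > D]
   had no power in [I], the stability for the first [D] indices would leave
   no monomial of [I] in the variables [x_1, ..., x_D, x_l], and coordinate
   primes containing [I] would form a chain contradicting [dim P/I = D].

   (v): if [x^mu] lies in [I : x_i^oo] but not in [I : x_j^oo], some multiple of it
   has as annihilator in [P/I] a prime generated by variables that contains
   [x_i] but not [x_j]. Conversely, an associated prime [ann f] contains with
   [x_j] all later variables, and comparing leading monomials modulo
   [I : x_(j-1)^oo] shows that nothing else is in it. *)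

Set Implicit Arguments.
Unset Strict Implicit.
Unset Printing Implicit Defensive.

(** Exponents found separately for finitely many generators, terms or variables can be replaced by
    their maximum. *)
Lemma exists_uniform_bound (T : eqType) (s : seq T) (P : T -> nat -> Prop) :
  (forall x t t', (t <= t')%N -> P x t -> P x t') ->
  (forall x, x \in s -> exists t, P x t) ->
  exists t, forall x, x \in s -> P x t.
Proof.
move=> Pmono; elim: s => [|a s IHs] hs; first by exists 0%N.
have [u hu] := IHs (fun x xs => hs x (mem_behead (s := a :: s) xs)).
have [v hv] := hs a (mem_head _ _).
exists (maxn u v) => x; rewrite inE => /orP[/eqP->|xs].
  by apply: Pmono hv; apply: leq_maxr.
by apply: Pmono (hu _ xs); apply: leq_maxl.
Qed.

Lemma bigminn_le (T : eqType) (r : seq T) (P : pred T) (F : T -> nat) n0 x :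
  x \in r -> P x -> (\big[minn/n0]_(i <- r | P i) F i <= F x)%N.
Proof.
elim: r => // a r IHr; rewrite inE big_cons => /orP[/eqP<-|xr] Px.
  by rewrite Px geq_minl.
case: ifP => _; last exact: IHr.
by rewrite geq_min IHr ?orbT.
Qed.

(** * Sets of exponents *)

Section Multinomials.
Context {n : nat}.
Implicit Types (A : set 'X_{1..n}) (m h mu rho : 'X_{1..n}) (i j l : 'I_n).

Lemma mnm_neq0P m : reflect (exists i, (0 < m i)%N) (m != 0%MM).
Proof.
apply: (iffP idP) => [m_neq0|[i mi]]; last first.
  by apply/eqP => m0; rewrite m0 mnm0E in mi.
apply/existsP; apply: contraNT m_neq0 => /existsPn m0.
by apply/eqP/mnmP => i; have := m0 i; rewrite mnm0E; lia.
Qed.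

Lemma submUK m i : (0 < m i)%N -> (m - U_(i) + U_(i))%MM = m.
Proof.
by move=> mi; rewrite submK //; apply/mnm_lepP => l; rewrite mnm1E; case: eqP => // <-.
Qed.

Lemma mnm_ind (P : 'X_{1..n} -> Prop) :
  P 0%MM -> (forall m i, P m -> P (m + U_(i))%MM) -> forall m, P m.
Proof.
move=> P0 PS m; have [d] := ubnP (mdeg m); elim: d m => // d IHd m ltmd.
have [/eqP->//|/mnm_neq0P[i mi]] := boolP (m == 0%MM).
rewrite -(submUK mi); apply/PS/IHd.
by move: ltmd; rewrite -{1}(submUK mi) mdegD mdeg1; lia.
Qed.

Lemma dickson A :
  exists2 G : seq 'X_{1..n}, (forall g, g \in G -> A g) &
    forall m, A m -> exists2 g, g \in G & (g <= m)%MM.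
Proof.
(* Induction on the number [d] of coordinates compared, for all [B] at once so that it also applies
   to slices of [B]. *)
suff: forall d, (d <= n)%N -> forall B : set 'X_{1..n},
    exists2 G : seq 'X_{1..n}, (forall g, g \in G -> B g) &
      forall m, B m -> exists2 g, g \in G & forall i, (i < d)%N -> (g i <= m i)%N.
  move=> /(_ n (leqnn n) A)[G GA hG]; exists G => // m /hG[g gG gm].
  by exists g => //; apply/mnm_lepP => i; apply: gm.
elim=> [_|d IHd ltdn] B.
  have [[b Bb]|nB] := pselect (exists b, B b); last first.
    by exists [::] => // m Bm; case: nB; exists m.
  by exists [:: b] => [g|m _]; [rewrite inE => /eqP->|exists b; rewrite ?mem_head].
have [G GB hG] := IHd (ltnW ltdn) B.
pose o := Ordinal ltdn.
have [N hN] : exists N, forall g, g \in G -> (g o <= N)%N.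
  apply: exists_uniform_bound => [x t t' ? /leq_trans|x _]; first exact.
  by exists (x o).
(* [N] bounds the new coordinate on [G], so [G] serves every [m] with [m o >= N]; the slices below
   [N] are added one by one. *)
have [G' G'B hG'] : exists2 G' : seq 'X_{1..n}, (forall g, g \in G' -> B g) &
    forall m, B m -> (m o < N)%N ->
      exists2 g, g \in G' & forall i, (i < d.+1)%N -> (g i <= m i)%N.
  elim: N {hN} => [|N [G' G'B hG']]; first by exists [::].
  have [G2 G2B hG2] := IHd (ltnW ltdn) (B `&` [set m | m o = N]).
  exists (G' ++ G2) => [g|m Bm].
    by rewrite mem_cat => /orP[/G'B//|/G2B[]].
  rewrite ltnS leq_eqVlt => /orP[/eqP mN|/(hG' _ Bm)[g gG' hg]]; last first.
    by exists g; rewrite // mem_cat gG'.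
  have [g gG2 hg] := hG2 m (conj Bm mN).
  exists g => [|i]; first by rewrite mem_cat gG2 orbT.
  rewrite ltnS leq_eqVlt => /orP[/eqP id_|/hg//].
  have -> : i = o by apply: val_inj.
  by rewrite mN; have [_ /= ->] := G2B _ gG2.
exists (G ++ G') => [g|m Bm].
  by rewrite mem_cat => /orP[/GB|/G'B].
have [/(hG' _ Bm)[g gG' hg]|leNm] := ltnP (m o) N.
  by exists g; rewrite // mem_cat gG' orbT.
have [g gG hg] := hG m Bm; exists g; first by rewrite mem_cat gG.
move=> i; rewrite ltnS leq_eqVlt => /orP[/eqP id_|/hg//].
have -> : i = o by apply: val_inj.
exact: leq_trans (hN _ gG) leNm.
Qed.

(** * Up-sets of exponents and stability *)

Definition upset A := forall m m', (m <= m')%MM -> A m -> A m'.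

Definition colon_var A l : set 'X_{1..n} :=
  [set m | exists t, A (m + U_(l) *+ t)%MM].

Definition stable A :=
  forall i j, (i < j)%N -> colon_var A i `<=` colon_var A j.

Ltac mnm_arith := rewrite ?(mnmDE, mnmBE, mulmnE, mnm1E, mnm0E, eqxx); lia.
Ltac mnm_eq := apply/mnmP => ?; mnm_arith.

Lemma colon_var_upset A l : upset A -> upset (colon_var A l).
Proof.
move=> hA m m' lemm' [t At]; exists t; apply: hA At.
by apply/mnm_lepP => i; move/mnm_lepP: lemm' => /(_ i); mnm_arith.
Qed.

Lemma sub_colon_var A l : A `<=` colon_var A l.
Proof. by move=> m Am; exists 0%N; rewrite mulm0n addm0. Qed.

Lemma colon_varK A l m t : colon_var A l (m + U_(l) *+ t)%MM -> colon_var A l m.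
Proof.
move=> [s As]; exists (t + s)%N; congr (A _): As; mnm_eq.
Qed.

(** The variables of [rho] are removed one at a time: each is exchanged for a power of [x_l], which
    the colon absorbs. *)
Lemma colon_var_cancel A l m rho : upset A ->
  (forall i, (0 < rho i)%N -> colon_var A i `<=` colon_var A l) ->
  colon_var A l (m + rho)%MM -> colon_var A l m.
Proof.
move=> hA; elim/mnm_ind: rho m => [|rho i IH] m hrho; first by rewrite addm0.
move=> [t At]; apply: IH => [i' i'rho|]; first by apply: hrho; mnm_arith.
apply: (@colon_varK _ _ _ t); apply: (hrho i); first by mnm_arith.
exists 1%N; congr (A _): At; mnm_eq.
Qed.

Lemma stableP A : upset A -> stable A <->
  forall mu i, A mu -> (0 < mu i)%N -> (i.+1 < n)%N ->
    forall r, (0 < r <= mu i)%N -> forall j, (i < j)%N ->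
    exists s, A (mu - U_(i) *+ r + U_(j) *+ s)%MM.
Proof.
move=> hA; split=> [Ast mu i Amu mui _ r hr j ltij|hs i j ltij m [t At]].
  apply: (Ast i j ltij); exists r; congr (A _): Amu; apply/mnmP => l.
  rewrite !(mnmDE, mnmBE, mulmnE, mnm1E).
  by case: (i =P l) => [<-|_] /=; lia.
case: t At => [|t] At; first by exists 0%N; rewrite mulm0n in At *.
have [|||s] := hs _ i At _ _ t.+1 _ j ltij.
- by mnm_arith.
- by have := ltn_ord j; lia.
- by mnm_arith.
by rewrite addmK; exists s.
Qed.

(** * Pommaret cones and the Pommaret basis *)

Definition lowest m i := (0 < m i)%N /\ forall j, (j < i)%N -> m j = 0%N.

Lemma exists_lowest m : m != 0%MM -> exists i, lowest m i.
Proof.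
move=> /mnm_neq0P[i0 mi0].
case: (arg_minnP (P := fun i => 0 < m i)%N (fun i : 'I_n => val i) mi0) => i mi le_i.
exists i; split=> // j ltji; apply/eqP; rewrite -leqn0 leqNgt.
by apply/negP => /le_i; rewrite leqNgt ltji.
Qed.

Lemma cls_le m i : (0 < m i)%N -> (cls m <= i.+1)%N.
Proof.
move=> mi; rewrite /cls (bigminn_le (fun i : 'I_n => i.+1)) ?mem_index_enum //.
by rewrite -lt0n.
Qed.

Lemma cls0 : cls (0%MM : 'X_{1..n}) = n.
Proof. by rewrite /cls big_pred0 // => i; rewrite mnm0E. Qed.

(** Indices count from 0 and classes from 1. The exponent 0 has no lowest index; its class comes
    from [cls0]. *)
Lemma cls_lowest m i : lowest m i -> cls m = i.+1.
Proof.
move=> [mi m0]; apply/eqP; rewrite eqn_leq cls_le //= /cls.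
elim/big_rec: _ => [|j c mj lec]; first exact: ltn_ord.
rewrite leq_min lec andbT ltnS leqNgt; apply/negP => /m0 mj0.
by rewrite mj0 in mj.
Qed.

Lemma mem_cone m : pommaret_cone m m.
Proof. by exists 0%MM => [j _|]; rewrite ?mnm0E ?addm0. Qed.

Lemma le_cone h m : pommaret_cone h m -> (h <= m)%MM.
Proof. by move=> [rho _ <-]; apply: lem_addr. Qed.

(** Since [x^h] divides [x^m], the class of [h] is at least that of [m], so multiplying by [x_i] is
    allowed in the cone of [h]. *)
Lemma cone_addU h m i :
  lowest m i -> pommaret_cone h (m - U_(i))%MM -> pommaret_cone h m.
Proof.
move=> [mi m0] [rho hrho e].
have {}e : (h + (rho + U_(i)))%MM = m.
  apply/mnmP => l; move/mnmP: e => /(_ l); rewrite !(mnmDE, mnmBE, mnm1E).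
  by case: (i =P l) => [<-|_] /=; lia.
exists (rho + U_(i))%MM => // j ltj.
have [eij|neij] := eqVneq i j; last first.
  by rewrite mnmDE mnm1E (negPf neij) hrho.
subst j; exfalso; have [h0|/exists_lowest[c hc]] := eqVneq h 0%MM.
  by move: ltj; rewrite h0 cls0; have := ltn_ord i; lia.
rewrite (cls_lowest hc) ltnS in ltj; have := m0 c ltj.
by case: hc => hc _; rewrite -e mnmDE; lia.
Qed.

(** If [x_i] did not occur in [rho], it would occur in [h]; then the nonzero [rho] would involve
    only variables before [x_i], which are absent from [m]. *)
Lemma cone_subU h m i : lowest m i -> m <> h ->
  pommaret_cone h m -> pommaret_cone h (m - U_(i))%MM.
Proof.
move=> [mi m0] neq_mh [rho hrho e].
have /mnm_neq0P[l rhol] : rho != 0%MM.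
  by apply/eqP => rho0; apply: neq_mh; rewrite -e rho0 addm0.
have rhoi : (0 < rho i)%N.
  rewrite lt0n; apply/eqP => rhoi0.
  have hi : (0 < h i)%N by move: mi; rewrite -e mnmDE rhoi0 addn0.
  have leli : (l <= i)%N.
    rewrite leqNgt; apply/negP => ltil; rewrite hrho // in rhol.
    by apply: leq_ltn_trans (cls_le hi) _; rewrite ltnS.
  have ltli : (l < i)%N.
    rewrite ltn_neqAle leli andbT; apply/eqP => /val_inj eli.
    by rewrite eli rhoi0 in rhol.
  by have := m0 l ltli; rewrite -e mnmDE; lia.
exists (rho - U_(i))%MM => [j ltj|]; first by rewrite mnmBE hrho.
rewrite -e; apply/mnmP => j; rewrite !(mnmDE, mnmBE, mnm1E).
by case: (i =P j) => [<-|_] /=; lia.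
Qed.

Lemma pommaret_stable A (H : set 'X_{1..n}) : upset A -> finite_set H ->
  A = \bigcup_(h in H) pommaret_cone h -> stable A.
Proof.
move=> hA /finite_seqP[s Hs] AE i j ltij m [t At].
have [N hN] : exists N, forall h, h \in s -> (h j <= N)%N.
  apply: exists_uniform_bound => [x u u' ? /leq_trans|x _]; first exact.
  by exists (x j).
(* The added power exceeds [h j] for every vertex [h], so [x_j] occurs in [rho]. Hence [h] has class
   beyond [j] and avoids [x_i]. *)
have : A (m + U_(i) *+ t + U_(j) *+ (m j + N).+1)%MM.
  by apply: hA At; exact: lem_addr.
rewrite {1}AE => -[h Hh]; have := Hh; rewrite Hs /= => /hN hjN [rho hrho e].
have rhoj : (0 < rho j)%N.
  by move/mnmP: e => /(_ j); rewrite !(mnmDE, mulmnE, mnm1E) eqxx; lia.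
have lejh : (j < cls h)%N.
  by rewrite ltnNge; apply/negP => /hrho rhoj0; rewrite rhoj0 in rhoj.
have hi : h i = 0%N.
  apply/eqP; rewrite -leqn0 leqNgt; apply/negP => /cls_le; lia.
exists (m j + N).+1; apply: (hA h); last by rewrite AE; exists h => //; apply: mem_cone.
apply/mnm_lepP => l; move/mnmP: e => /(_ l).
rewrite !(mnmDE, mulmnE, mnm1E); case: (i =P l) => [<-|_] /=; last by lia.
by rewrite hi.
Qed.

(** The exponent 0, having no lowest variable, is a generator as soon as it lies in [A]. *)
Definition pommaret_gens A : set 'X_{1..n} :=
  [set h | A h /\ forall i, lowest h i -> ~ A (h - U_(i))%MM].

(** Dividing by the lowest variable while staying in [A] ends at a generator, and [cone_addU] leads
    back up to [m]. *)
Lemma pommaret_gens_cover A : upset A ->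
  A = \bigcup_(h in pommaret_gens A) pommaret_cone h.
Proof.
move=> hA; apply/seteqP; split=> [m|m [h [Ah _] /le_cone hm]]; last exact: hA Ah.
have [d] := ubnP (mdeg m); elim: d m => // d IHd m ltmd Am.
have [gm|/not_andP[//|/existsNP[i /not_implyP[mi /contrapT Ami]]]] :=
  pselect (pommaret_gens A m); first by exists m => //; apply: mem_cone.
have [|h Hh hm] := IHd _ _ Ami; last by exists h => //; apply: cone_addU hm.
case: mi => mi _.
by move: ltmd; rewrite -{1}(submUK mi) mdegD mdeg1; lia.
Qed.

(** A common element, divided repeatedly by its lowest variable, stays in both cones until it meets
    a vertex. If it is not the other vertex too, one more division stays in [A] by [cone_subU],
    against minimality. *)
Lemma pommaret_gens_trivIset A : upset A ->
  classical_sets.trivIset (pommaret_gens A) (@pommaret_cone n).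
Proof.
move=> hA h1 h2 [Ah1 min1] [Ah2 min2] [m [m1 m2]].
have [d] := ubnP (mdeg m); elim: d m m1 m2 => // d IHd m m1 m2 ltmd.
have [m0|/exists_lowest[i mi]] := eqVneq m 0%MM.
  have le0 h : (h <= 0)%MM -> h = 0%MM.
    by move=> /mnm_lepP le; apply/mnmP => l; have := le l; rewrite mnm0E; lia.
  by rewrite m0 in m1 m2; rewrite (le0 _ (le_cone m1)) (le0 _ (le_cone m2)).
have [e1|/eqP ne1] := eqVneq m h1; have [e2|/eqP ne2] := eqVneq m h2.
- by rewrite -e1 -e2.
- case: (min1 i); rewrite -e1 //.
  by apply: hA Ah2; apply/le_cone/cone_subU.
- case: (min2 i); rewrite -e2 //.
  by apply: hA Ah1; apply/le_cone/cone_subU.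
apply: (IHd (m - U_(i))%MM); [exact: cone_subU|exact: cone_subU|].
case: mi => mi _.
by move: ltmd; rewrite -{1}(submUK mi) mdegD mdeg1; lia.
Qed.

Lemma finite_mdeg_lt (d : nat) : finite_set [set m : 'X_{1..n} | (mdeg m < d)%N].
Proof.
apply: (@sub_finite_set _ _ [set bmnm x | x in [set: 'X_{1..n < d}]]).
  by move=> m md; exists (BMultinom md).
exact/finite_image/finite_finset.
Qed.

(** Let [g] be a Dickson generator dividing [h]. Minimality of [h] forces [g c = h c] at the lowest
    index [c], and later exponents are bounded because stability trades one [x_c] in [g] for [N]
    factors [x_j]. *)
Lemma pommaret_gens_finite A : upset A -> stable A -> finite_set (pommaret_gens A).
Proof.
move=> hA Ast; have [G GA hG] := dickson A.
have [N hN] : exists N, forall x : 'X_{1..n} * ('I_n * 'I_n),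
    x \in [seq (g, ij) | g <- G, ij <- enum {: 'I_n * 'I_n}] ->
    forall i j, x.2 = (i, j) -> (x.1 i <= N)%N /\ 
      ((i < j)%N -> (0 < x.1 i)%N -> A (x.1 - U_(i) + U_(j) *+ N)%MM).
  apply: exists_uniform_bound => [x t t' tt' hx i j /(hx i j)[le1 A1]|].
    split=> [|ij xi]; first exact: leq_trans tt'.
    by apply: hA (A1 ij xi); apply/mnm_lepP => l; mnm_arith.
  move=> [g [i j]] /allpairsP[[g' ij] /= [gG _ [-> _]]].
  have [[ltij gi]|nij] := pselect ((i < j)%N /\ (0 < g' i)%N); last first.
    by exists (g' i) => _ _ [<- <-]; split=> // ij' gi; case: nij.
  have [//|t At] := Ast i j ltij (g' - U_(i))%MM.
    by exists 1%N; rewrite mulm1n submUK //; apply: GA.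
  exists (maxn (g' i) t) => _ _ [<- <-]; split=> [|_ _]; first exact: leq_maxl.
  by apply: hA At; apply/mnm_lepP => l; mnm_arith.
have {}hN g i j : g \in G -> (g i <= N)%N /\
      ((i < j)%N -> (0 < g i)%N -> A (g - U_(i) + U_(j) *+ N)%MM).
  move=> gG; apply: (hN (g, (i, j))) => //.
  by apply/allpairsP; exists (g, (i, j)); rewrite mem_enum.
apply: (@sub_finite_set _ _ _ _ (finite_mdeg_lt (n * (N + N).+1).+1)).
move=> h [Ah hmin] /=; rewrite ltnS mdegE -[in leqRHS](card_ord n) -sum_nat_const.
apply: leq_sum => j _; have [h0|/exists_lowest[c hc]] := eqVneq h 0%MM.
  by rewrite h0 mnm0E.
have [g gG /mnm_lepP legh] := hG h Ah.
have nAh := hmin c hc; case: hc => hc h0.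
have gc : g c = h c.
  apply/eqP; rewrite eqn_leq legh leqNgt; apply/negP => ltgh; apply: nAh.
  apply: hA (GA _ gG); apply/mnm_lepP => l; have := legh l.
  by rewrite mnmBE mnm1E; case: (c =P l) => [<-|_] /=; lia.
have [ltjc|ltcj|/val_inj ejc] := ltngtP j c; first by rewrite h0.
  (* Otherwise [g - U_(c) + U_(j) *+ N], which lies in [A], would divide [h - U_(c)]. *)
  rewrite leqNgt; apply/negP => lthj; apply: nAh.
  have [_ /(_ ltcj)] := hN g c j gG; rewrite gc => /(_ hc); apply: hA.
  apply/mnm_lepP => l; have := legh l; rewrite !(mnmDE, mnmBE, mulmnE, mnm1E).
  have [gj _] := hN g j j gG.
  case: (j =P l) => [<-|_] /=; lia.
have [le _] := hN g c c gG; rewrite ejc -gc; lia.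
Qed.

(** * Consequences of the dimension, and monomials with prime annihilator *)

Lemma card_ord_lt j : #|[set i : 'I_n | (i < j)%N]%SET| = j.
Proof.
rewrite cardsE -sum1_card; have ltjn := ltnW (ltn_ord j).
by rewrite -[RHS]card_ord -sum1_card (big_ord_widen n (fun=> 1%N) ltjn).
Qed.

(* The coordinate subspaces in the zero set of a monomial ideal with monomials
   [A] are those spanned by the [W] such that every monomial in [A] involves a
   variable outside [W]. *)
Definition dim_bounded A (D : int) :=
  forall W : {set 'I_n},
    (forall mu, A mu -> exists2 i, i \notin W & (0 < mu i)%N) -> #|W|%:Z <= D.

(** By cancellation, a monomial of [A] in [x_l] and the first [j] variables yields a power of [x_l]
    in [A]. Without such a power, these [j + 1] variables would span a coordinate subspace too large
    for [D]. *)
Lemma colon_var_full A D j l : upset A -> dim_bounded A D ->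
  (j <= l)%N -> D < (j.+1)%:Z ->
  (forall i, (i < j)%N -> colon_var A i `<=` colon_var A l) ->
  colon_var A l 0%MM.
Proof.
move=> hA hD lejl ltDj hj; apply: contrapT => nAl.
pose W := l |: [set i : 'I_n | (i < j)%N]%SET.
have cardW : #|W| = j.+1.
  by rewrite cardsU1 card_ord_lt inE ltnNge lejl.
suff : #|W|%:Z <= D by rewrite cardW leNgt ltDj.
apply: hD => mu Amu; apply: contrapT => hmu; apply: nAl.
apply: (@colon_var_cancel A l 0%MM mu) => // [i mui|]; last first.
  by rewrite addmC addm0; apply: sub_colon_var.
have : i \in W by apply: contrapT => /negP iW; apply: hmu; exists i.
by rewrite !inE => /orP[/eqP->//|]; apply: hj.
Qed.

Lemma stable_of_initial_conditions A D : upset A -> dim_bounded A D ->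
  (forall j, j = 0%N :> nat \/ (j%:Z < D) ->
     forall mu, (forall i, (i < j)%N -> mu i = 0%N) -> colon_var A j mu ->
     forall l, (j <= l)%N -> colon_var A l mu) -> stable A.
Proof.
move=> hA hD h2 i; have [d] := ubnP (nat_of_ord i); elim: d i => // d IHd j ltjd l ltjl m.
have IH i l' : (i < j)%N -> (j <= l')%N -> colon_var A i `<=` colon_var A l'.
  by move=> ltij lejl'; apply: IHd; lia.
have [hj|hj] := pselect (j = 0%N :> nat \/ (j%:Z < D)); last first.
  (* Here [j >= D], so a power of [x_l] lies in [A] and the colon is everything. *)
  move=> _; apply: (colon_var_upset hA (m := 0%MM)).
    by apply/mnm_lepP => x; mnm_arith.
  apply: (colon_var_full (j := j) hA hD); [by lia|by lia|].
  by move=> i ltij; apply: IH => //; lia.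
(* [h2] speaks only of monomials free of the variables before [x_j]; the part [lo] in those
   variables is first cancelled by induction. *)
pose lo := [multinom if (i < j)%N then m i else 0%N | i < n].
have elo : m = ((m - lo) + lo)%MM.
  apply/mnmP => x; rewrite !(mnmDE, mnmBE, mnmE); case: ifP => _; lia.
rewrite {1}elo => Aj.
apply: (colon_var_upset hA (m := (m - lo)%MM)); first exact: lem_subr.
apply: h2 hj _ _ _ _ (ltnW ltjl) => [x ltxj|].
  by rewrite mnmBE mnmE ltxj subnn.
apply: (colon_var_cancel hA (rho := lo)) Aj => x.
by rewrite mnmE; case: ifP => // ltxj _; apply: IH.
Qed.

(* Choose a multiple of [mu] outside [colon_var A j] for which as many single
   variables as possible lead into [colon_var A j], and multiply it by a large
   power of the [j]th variable. *)
Lemma exists_prime_colon A i j mu : upset A ->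
  colon_var A i mu -> ~ colon_var A j mu ->
  exists nu, exists2 V : {set 'I_n}, i \in V /\ j \notin V &
    forall rho, A (nu + rho)%MM <-> exists2 l, l \in V & (0 < rho l)%N.
Proof.
move=> hA Ai nAj; have hAj := @colon_var_upset _ j hA.
pose V nu : {set 'I_n} := [set l | `[< colon_var A j (nu + U_(l))%MM >]]%SET.
pose P d := `[< exists nu, [/\ ~ colon_var A j nu, (mu <= nu)%MM & #|V nu| = d] >].
have exP : exists d, P d.
  by exists #|V mu|; apply/asboolP; exists mu; split=> //; apply: lepm_refl.
have leP d : P d -> (d <= n)%N.
  by move=> /asboolP[nu [_ _ <-]]; rewrite -[leqRHS]card_ord max_card.
case: (ex_maxnP exP leP) => d /asboolP[nu [nAnu lemu cardV]] dmax.
have Vup nu' : (nu <= nu')%MM -> V nu \subset V nu'.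
  move=> le; apply/subsetP => l; rewrite !inE => /asboolP Al; apply/asboolP.
  by apply: hAj Al; apply/mnm_lepP => x; move/mnm_lepP: le => /(_ x); mnm_arith.
(* By maximality of [#|V nu|]: the first variable outside [V nu] that led into the colon would
   enlarge the set at [nu + rho]. *)
have Voff rho : (forall l, l \in V nu -> rho l = 0%N) -> ~ colon_var A j (nu + rho)%MM.
  elim/mnm_ind: rho => [|rho l IH] hrho; first by rewrite addm0.
  have nArho : ~ colon_var A j (nu + rho)%MM.
    by apply: IH => x /hrho; rewrite mnmDE; lia.
  have lV : l \notin V nu by apply/negP => /hrho; mnm_arith.
  rewrite addmA => Al; have lenu := @lem_addr _ nu rho.
  have lV' : l \in V (nu + rho)%MM by rewrite inE; apply/asboolP.
  have /dmax : P #|V (nu + rho)%MM|.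
    by apply/asboolP; exists (nu + rho)%MM; split=> //; exact: lepm_trans lemu lenu.
  rewrite -cardV leqNgt => /negP; apply; apply: proper_card.
  by apply/properP; split; [exact: Vup|exists l].
have [s hs] : exists s, forall l, l \in enum (V nu) ->
    A (nu + U_(l) + U_(j) *+ s)%MM.
  apply: exists_uniform_bound => [l t t' le|l].
    by apply: hA; apply/mnm_lepP => x; mnm_arith.
  by rewrite mem_enum inE => /asboolP.
exists (nu + U_(j) *+ s)%MM, (V nu) => [|rho]; first split.
- apply: contrapT => /negP iV; case: Ai => t At.
  apply: (Voff (U_(i) *+ t)%MM) => [l lV|].
    rewrite mulmnE mnm1E; case: eqP => // eil.
    by rewrite eil lV in iV.
  apply: sub_colon_var; apply: hA At.
  by apply/mnm_lepP => x; move/mnm_lepP: lemu => /(_ x); mnm_arith.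
- rewrite inE; apply/asboolP => Aj; apply: nAnu.
  by apply: (@colon_varK A j nu 1%N); rewrite mulm1n.
split=> [Arho|[l lV rhol]]; last first.
  apply: hA (hs l _); last by rewrite mem_enum.
  apply/mnm_lepP => x; rewrite !(mnmDE, mulmnE, mnm1E).
  by case: (l =P x) => [<-|_] /=; lia.
apply: contrapT => nrho; apply: (Voff rho) => [l lV|].
  by apply/eqP; rewrite -leqn0 leqNgt; apply/negP => rhol; apply: nrho; exists l.
apply: (@colon_varK A j _ s); apply: sub_colon_var; congr (A _): Arho; mnm_eq.
Qed.

End Multinomials.

(** * Ideals given by the supports of their elements *)

Section PolynomialIdeals.
Context {k : fieldType} {n : nat}.
Implicit Types (I J : set {mpoly k[n]}) (f g : {mpoly k[n]}).
Implicit Types (A B : set 'X_{1..n}) (V : set 'I_n) (m mu : 'X_{1..n}).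

(** The colon ideals, saturations and sums with variables below take this form, so comparing them
    reduces to comparing sets of exponents. *)
Definition supp_in A : set {mpoly k[n]} :=
  [set f | forall m, m \in msupp f -> A m].

Lemma supp_inX A m : supp_in A 'X_[m] <-> A m.
Proof.
rewrite /supp_in /= msuppX; split=> [|Am m']; first by apply; rewrite inE.
by rewrite inE => /eqP->.
Qed.

Lemma supp_inS A B : A `<=` B -> supp_in A `<=` supp_in B.
Proof. by move=> AB f fA m /fA/AB. Qed.

Lemma supp_inD A f g : supp_in A f -> supp_in A g -> supp_in A (f + g).
Proof. by move=> fA gA m /msuppD_le; rewrite mem_cat => /orP[/fA|/gA]. Qed.

Lemma supp_inM A B C f g : (forall m m', A m -> B m' -> C (m + m')%MM) ->
  supp_in A f -> supp_in B g -> supp_in C (f * g).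
Proof.
by move=> ABC fA gB m /msuppM_le/allpairsP[[m1 m2] /= [/fA Am1 /gB Bm2 ->]]; apply: ABC.
Qed.

Lemma ideal_supp_in A : upset A -> ideal (supp_in A).
Proof.
move=> hA; split=> [m|f g|f g gA]; first by rewrite msupp0.
  exact: supp_inD.
apply: (@supp_inM classical_sets.setT A A f g _ _ gA) => // m m' _.
by apply: hA; exact: lem_addl.
Qed.

Lemma supp_in_sub A J : ideal J -> (forall m, A m -> J 'X_[m]) -> supp_in A `<=` J.
Proof.
move=> [J0 JD JM] AJ f fA; rewrite [f]mpolyE big_seq.
elim/big_rec: _ => // m g mf Jg; apply: JD => //.
by rewrite -mul_mpolyC; apply/JM/AJ/fA.
Qed.

Lemma ideal_ideal_gen (S : set {mpoly k[n]}) : ideal (ideal_gen S).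
Proof.
split=> [J [[J0 _ _] _] //|f g fS gS J hJ|f g gS J hJ]; have [[_ JD JM] _] := hJ.
  by apply: JD; [apply: fS|apply: gS].
by apply: JM; apply: gS.
Qed.

Lemma ideal_gen_min (S J : set {mpoly k[n]}) : ideal J -> S `<=` J -> ideal_gen S `<=` J.
Proof. by move=> hJ SJ; apply: smallest_sub. Qed.

Lemma mem_ideal_gen (S : set {mpoly k[n]}) : S `<=` ideal_gen S.
Proof. exact: sub_gen_smallest. Qed.

Lemma monomial_idealP I : monomial_ideal I ->
  upset [set m | I 'X_[m]] /\ I = supp_in [set m | I 'X_[m]].
Proof.
move=> [M eI]; have hI : ideal I by rewrite eI; apply: ideal_ideal_gen.
have up : upset [set m | I 'X_[m]].
  move=> m m' /submK <- /= Im; rewrite mpolyXD; by case: hI => _ _; apply.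
split=> //; apply/seteqP; split; last by apply: supp_in_sub.
rewrite {1}eI; apply: ideal_gen_min; first exact: ideal_supp_in.
move=> _ [m Mm <-]; apply/supp_inX; rewrite /= eI; apply: mem_ideal_gen.
by exists m.
Qed.

(** * Colon ideals and saturations *)

Lemma supp_in_mulX A f m :
  supp_in A (f * 'X_[m]) <-> supp_in [set m' | A (m' + m)%MM] f.
Proof.
split=> fA m'.
  move=> m'f; apply: fA; rewrite (perm_mem (msuppMX f m)) addmC.
  exact: map_f.
by rewrite (perm_mem (msuppMX f m)) => /mapP[m'' /fA ? ->]; rewrite addmC.
Qed.

Lemma supp_in_colon_var A f l : upset A ->
  supp_in (colon_var A l) f <-> exists t, supp_in A (f * 'X_l ^+ t).
Proof.
move=> hA; split=> [fA|[t]].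
  have [x t t' le|m /fA //|t ht] := @exists_uniform_bound _ (msupp f)
      (fun m t => A (m + U_(l) *+ t)%MM).
    by apply: hA; apply/mnm_lepP => j; rewrite !mnmDE !mulmnE leq_add2l leq_mul2l le orbT.
  by exists t; rewrite mpolyXn; apply/supp_in_mulX.
by rewrite mpolyXn => /supp_in_mulX fA m /fA; exists t.
Qed.

(** Pigeonhole: a monomial of large degree in the variables of [V] contains a high power of one of
    them. Both colon ideals and saturations reduce to this. *)
Lemma powers_annihilate J f V : ideal J ->
  (forall l, V l -> exists t, J (f * 'X_l ^+ t)) ->
  exists d, supp_in [set m | (d <= \sum_(l < n | `[< V l >]) m l)%N]
    `<=` [set g | J (f * g)].
Proof.
move=> [J0 JD JM] hf.
have [|l _|N hN] := @exists_uniform_bound _ (enum 'I_n)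
    (fun l t => V l -> J (f * 'X_l ^+ t)).
- move=> l t t' le h /h Jt; rewrite -(subnK le) exprD mulrCA; exact: JM.
- have [Vl|nVl] := pselect (V l); last by exists 0%N => /nVl.
  by have [t] := hf l Vl; exists t.
exists (n * N).+1; apply: supp_in_sub => [|m /= hm].
  split=> [|g h Jg Jh|g h Jh] /=; first by rewrite mulr0.
    by rewrite mulrDr; apply: JD.
  by rewrite mulrCA; apply: JM.
have [l Vl ltNm] : exists2 l, V l & (N <= m l)%N.
  apply: contrapT => nm; move: hm; rewrite ltnNge => /negP; apply.
  rewrite -[X in (X * N)%N]card_ord -sum_nat_const.
  rewrite big_mkcond /=; apply: leq_sum => l _; case: asboolP => // Vl.
  by apply/ltnW; rewrite ltnNge; apply/negP => le; apply: nm; exists l.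
have -> : m = (m - U_(l) *+ N + U_(l) *+ N)%MM.
  rewrite submK //; apply/mnm_lepP => j; rewrite mulmnE mnm1E.
  by case: eqP => [<-|_]; rewrite ?mul1n ?mul0n.
rewrite mpolyXD -mpolyXn mulrCA; apply: JM; apply: hN => //.
by rewrite mem_enum.
Qed.

(** Every term of an element of the [d]-th power has degree at least [d] in the variables of [V], so
    [powers_annihilate] applies. *)
Lemma colon_infP J f V : ideal J ->
  colon_inf J (ideal_gen [set 'X_l | l in V]) f <->
  forall l, V l -> exists t, J (f * 'X_l ^+ t).
Proof.
move=> hJ; split=> [[d hd] l Vl|/(powers_annihilate hJ)[d hd]].
  exists d; apply: hd; exists ('X_l ^+ d) => //.
  elim: d => //= d IHd; rewrite exprS; apply: mem_ideal_gen.
  by exists 'X_l; first (by apply: mem_ideal_gen; exists l); exists ('X_l ^+ d).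
exists d => _ [g hg <-]; apply: hd.
elim: d g hg => [//|d IHd] g /=.
have up e : upset [set m : 'X_{1..n} | (e <= \sum_(l < n | `[< V l >]) m l)%N].
  move=> m m' /mnm_lepP le /leq_trans; apply; apply: leq_sum => l _; exact: le.
apply: ideal_gen_min; first exact: (ideal_supp_in (up d.+1)).
move=> _ [u hu [v hv <-]]; apply: supp_inM (IHd v hv); last first.
  apply: (ideal_gen_min (ideal_supp_in (up 1%N)) _ hu).
  move=> _ [l Vl <-]; apply/supp_inX => /=.
  by rewrite (bigD1 l) /= ?mnm1E ?eqxx //; apply/asboolP.
move=> m m' /= hm hm'; under eq_bigr do rewrite mnmDE.
by rewrite big_split /= -add1n leq_add.
Qed.

Lemma saturationP J f : ideal J ->
  saturation J f <-> forall l, exists t, J (f * 'X_l ^+ t).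
Proof.
move=> hJ; split=> [[d hd] l|hf].
  by exists d; apply: hd; rewrite mpolyXn dhomogX /= mdegMn mdeg1 mul1n.
have [d hd] := @powers_annihilate J f classical_sets.setT hJ (fun l _ => hf l).
exists d => g /dhomogP hg; apply: hd => m /hg /= <-.
by rewrite mdegE [leqRHS](eq_bigl xpredT) // => l; apply: asboolT.
Qed.

Lemma saturation_supp_in A : upset A ->
  saturation (supp_in A) = supp_in [set m | forall l, colon_var A l m].
Proof.
move=> hA; apply/seteqP; split=> f.
  move=> /(saturationP _ (ideal_supp_in hA)) hf m mf l.
  by apply: (supp_in_colon_var _ _ hA).2 mf; apply: hf.
move=> fA; apply/(saturationP _ (ideal_supp_in hA)) => l.
by apply/(supp_in_colon_var _ _ hA) => m /fA.
Qed.

Lemma nonzerodivisor_supp_in A (j : 'I_n) :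
  nonzerodivisor_quot (supp_in A) 'X_j <-> forall m, A (m + U_(j))%MM -> A m.
Proof.
split=> [h m Am|h f].
  by apply/supp_inX/h; rewrite mulrC -mpolyXD; apply/supp_inX.
by rewrite mulrC => /supp_in_mulX fA m /fA/h.
Qed.

(** * Ideals and primes generated by variables *)

Definition involves V : set 'X_{1..n} := [set m | exists2 l, V l & (0 < m l)%N].

Lemma involves_upset V : upset (involves V).
Proof. by move=> m m' /mnm_lepP le [l Vl /leq_trans ml]; exists l => //; apply: ml. Qed.

Lemma involves1 V l : involves V U_(l)%MM <-> V l.
Proof.
split=> [[l' Vl']|Vl]; last by exists l; rewrite // mnm1E eqxx.
by rewrite mnm1E; case: eqP => // ->.
Qed.

Lemma ideal_gen_addX A V : upset A ->
  ideal_gen (supp_in A `|` [set 'X_l | l in V]) = supp_in (A `|` involves V).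
Proof.
move=> hA; apply/seteqP; split.
  apply: ideal_gen_min.
    apply: ideal_supp_in => m m' le [Am|Vm]; first by left; apply: hA le Am.
    by right; apply: involves_upset le Vm.
  move=> f [fA|[l Vl <-]]; first by apply: supp_inS fA; left.
  by apply/supp_inX; right; apply/involves1.
have hS := ideal_ideal_gen (supp_in A `|` [set 'X_l | l in V]).
apply: supp_in_sub => // m [Am|[l Vl ml]].
  by apply: mem_ideal_gen; left; apply/supp_inX.
rewrite -(submUK ml) mpolyXD; case: hS => _ _; apply; apply: mem_ideal_gen; right.
by exists l.
Qed.

Lemma ideal_gen_vars V : ideal_gen [set 'X_l | l in V] = supp_in (involves V).
Proof.
have := @ideal_gen_addX classical_sets.set0 V; rewrite classical_sets.set0U => <- //.
have -> : supp_in classical_sets.set0 = [set 0].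
  apply/seteqP; split=> f; last by move=> -> m; rewrite msupp0.
  rewrite /supp_in /= => hf; apply: msuppnil0; case: (msupp f) hf => // m s hf.
  by case: (hf m); apply: mem_head.
apply/seteqP; split; apply: ideal_gen_min; try exact: ideal_ideal_gen.
  by move=> f hf; apply: mem_ideal_gen; right.
move=> f [->|hf]; last exact: mem_ideal_gen.
by case: (ideal_ideal_gen [set 'X_l | l in V]).
Qed.

Lemma supp_in_split A f : exists f1 f2,
  [/\ f = f1 + f2, supp_in A f1 & supp_in [set m | ~ A m] f2].
Proof.
exists (\sum_(m <- msupp f | `[< A m >]) f@_m *: 'X_[m]).
exists (\sum_(m <- msupp f | ~~ `[< A m >]) f@_m *: 'X_[m]); split.
- by rewrite [LHS]mpolyE (bigID (fun m => `[< A m >])).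
- apply: (big_ind (supp_in A)) => [m||m /asboolP Am m'].
  + by rewrite msupp0.
  + exact: supp_inD.
  + by move=> /msuppZ_le; rewrite msuppX inE => /eqP ->.
- apply: (big_ind (supp_in [set m | ~ A m])) => [m||m /asboolP nAm m'].
  + by rewrite msupp0.
  + exact: supp_inD.
  + by move=> /msuppZ_le; rewrite msuppX inE => /eqP ->.
Qed.

(* Up to [supp_in A], no term of [f] lies in [A]; then the leading monomial of
   [f * g] does not lie in [A] either unless [f] vanishes. *)
Lemma supp_in_cancel A f g : upset A -> g != 0 ->
  (forall m m', m' \in msupp g -> A (m + m')%MM -> A m) ->
  supp_in A (f * g) -> supp_in A f.
Proof.
move=> hA g0 hg; have [A0 AD AM] := ideal_supp_in hA.
have [f1 [f2 [-> f1A f2A]]] := supp_in_split A f => fgA.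
have f2g : supp_in A (f2 * g).
  have -> : f2 * g = (f1 + f2) * g + (- g) * f1 by ring.
  by apply: AD => //; apply: AM.
have [->|f20] := eqVneq f2 0; first by rewrite addr0.
have lA : A (mlead (f2 * g)) by apply: f2g; apply: mlead_supp; rewrite mulf_neq0.
rewrite mleadM // in lA; case: (f2A (mlead f2)); first exact: mlead_supp.
by apply: hg lA; apply: mlead_supp.
Qed.

(** Once the terms of [g] in the ideal are dropped, the remaining ones are free of [V], and a factor
    free of [V] cannot bring a monomial into the ideal. *)
Lemma prime_involves V : prime_ideal (supp_in (involves V)).
Proof.
have hV := @involves_upset V; have [_ VD VM] := ideal_supp_in hV.
split=> [|h1|f g fgV]; first exact: ideal_supp_in.
  have : supp_in (involves V) 'X_[0%MM] by rewrite mpolyX0.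
  by move=> /supp_inX[l _]; rewrite mnm0E.
have [g1 [g2 [eg g1V g2V]]] := supp_in_split (involves V) g.
have [g20|g2_neq0] := eqVneq g2 0; first by right; rewrite eg g20 addr0.
left; apply: (supp_in_cancel (g := g2)) => // [m m' m'g2 [l Vl]|].
  rewrite mnmDE addn_gt0 => /orP[ml|m'l]; first by exists l.
  by case: (g2V _ m'g2); exists l.
have -> : f * g2 = f * g + (- f) * g1 by rewrite eg; ring.
by apply: VD => //; apply: VM.
Qed.

(* The primes between [< x_l | l notin W >] and [< x_1, ..., x_n >] obtained by
   adding the variables in [W] one at a time. *)
Lemma coordinate_prime_chain A (W : {set 'I_n}) :
  (forall m, A m -> exists2 i, i \notin W & (0 < m i)%N) ->
  prime_chain (supp_in A) #|W| (fun e =>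
    supp_in (involves [set l | l \notin W \/ (index l (enum W) < e)%N])).
Proof.
move=> hW; split=> [e _|e ltew].
  split; first exact: prime_involves.
  by apply: supp_inS => m /hW[i iW mi]; exists i => //; left.
pose w := enum_val (Ordinal ltew).
have wW : w \in W by apply: enum_valP.
have iw : index w (enum W) = e.
  by rewrite /w (enum_val_nth w) index_uniq ?enum_uniq // -cardE.
split.
  by apply: supp_inS => m [i [iW|ltie] mi]; exists i => //; [left|right; apply: leqW].
move=> /(_ 'X_w) h; have : supp_in (involves
    [set l | l \notin W \/ (index l (enum W) < e)%N]) 'X_w.
  by apply: h; apply/supp_inX/involves1; right; rewrite iw.
move=> /supp_inX/involves1 [|]; first by rewrite wW.
by rewrite iw ltnn.
Qed.

Lemma chains_bounded_dim_bounded A D :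
  chains_bounded (supp_in A) D -> dim_bounded A D.
Proof. by move=> hD W /coordinate_prime_chain/hD. Qed.

(** * Associated primes *)

Lemma vars_fromE (j : 'I_n) :
  vars_from j = supp_in (involves [set l : 'I_n | (j <= l)%N]).
Proof. exact: ideal_gen_vars. Qed.

Lemma associated_prime_stable A : upset A ->
  (forall p, associated_prime (supp_in A) p -> exists j : 'I_n, p = vars_from j) ->
  stable A.
Proof.
move=> hA h5 i j ltij mu Ai; apply: contrapT => nAj.
have [nu [V [iV jV] hV]] := exists_prime_colon hA Ai nAj.
pose V' : set 'I_n := [set l | l \in V].
(* The annihilator of [x^nu] is generated by the variables in [V], so it contains [x_i] but not
   [x_j]. *)
have [|j0 e] := h5 (supp_in (involves V')).
  split; first exact: prime_involves.
  exists 'X_[nu]; apply/seteqP; split=> g.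
    move=> gV; apply/supp_in_mulX => m /gV mV.
    by rewrite /= addmC; apply/hV.
  move=> /supp_in_mulX gA m /gA /=; rewrite addmC => /hV mV.
  exact: mV.
rewrite vars_fromE in e.
have /involves1/= lej0i : involves [set l : 'I_n | (j0 <= l)%N] U_(i)%MM.
  by apply/supp_inX; rewrite -e; apply/supp_inX/involves1.
have /involves1 : involves V' U_(j)%MM.
  by apply/supp_inX; rewrite e; apply/supp_inX/involves1; apply: leq_trans lej0i (ltnW _).
exact: (negP jV).
Qed.

Lemma prime_ideal_expr (p : set {mpoly k[n]}) f t :
  prime_ideal p -> p (f ^+ t) -> p f.
Proof.
move=> [_ p1 pM]; elim: t => [|t IHt]; first by rewrite expr0.
by rewrite exprS => /pM[].
Qed.

Lemma prime_ideal_mpolyX (p : set {mpoly k[n]}) m :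
  prime_ideal p -> p 'X_[m] -> exists l, p 'X_l.
Proof.
move=> [_ p1 pM]; elim/(@mnm_ind n): m => [|m l IHm]; first by rewrite mpolyX0.
by rewrite mpolyXD => /pM[/IHm//|]; exists l.
Qed.

Lemma stable_associated_prime A p : upset A -> stable A ->
  supp_in A <> [set 0] -> associated_prime (supp_in A) p ->
  exists j : 'I_n, p = vars_from j.
Proof.
move=> hA Ast I0 [hp [f ep]]; have [[p0 pD pM] p1 pMV] := hp.
(* Since [p] is prime, a power of [x_l] that kills [f] modulo the ideal already puts [x_l] in
   [p]. *)
have pX l : p 'X_l <-> supp_in (colon_var A l) f.
  split=> [|/(supp_in_colon_var _ _ hA)[t ft]].
    rewrite ep /= => hl; apply/(supp_in_colon_var _ _ hA); exists 1%N.
    by rewrite expr1 mulrC.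
  by apply: (@prime_ideal_expr p _ t) => //; rewrite ep /= mulrC.
(* A nonzero monomial ideal contains a monomial, and the prime [p] above it then contains a
   variable. *)
have [l0 pl0] : exists l, p 'X_l.
  have [m Am] : exists m, A m.
    apply: contrapT => nA; apply: I0; apply/seteqP; split=> g; last first.
      by move=> -> m; rewrite msupp0.
    move=> gA; apply: contrapT => /eqP g0.
    by apply: nA; exists (mlead g); apply/gA/mlead_supp.
  apply: (@prime_ideal_mpolyX p m) => //; rewrite ep /= mulrC.
  by have [_ _] := ideal_supp_in hA; apply; apply/supp_inX.
case: (@arg_minnP _ l0 (fun l => `[< p 'X_l >]) (fun l : 'I_n => val l)).
  exact/asboolP.
move=> j /asboolP pj jmin.
have varsp : vars_from j `<=` p.
  apply: ideal_gen_min => // _ [l lejl <-]; move: lejl; rewrite /= leq_eqVlt.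
  move=> /orP[/eqP/val_inj<-//|ltjl]; apply/pX; apply: supp_inS (Ast j l ltjl) _ _.
  exact/pX.
exists j; apply/seteqP; split=> // g pg; rewrite vars_fromE.
have [g1 [g2 [eg g1V g2V]]] := supp_in_split (involves [set l : 'I_n | (j <= l)%N]) g.
have [g20|g2_neq0] := eqVneq g2 0; first by rewrite eg g20 addr0.
have g2lt m l : m \in msupp g2 -> (0 < m l)%N -> (l < j)%N.
  by move=> /g2V mV ml; rewrite ltnNge; apply/negP => le; apply: mV; exists l.
have fg2 : supp_in A (f * g2).
  suff : p g2 by rewrite ep /= mulrC.
  have -> : g2 = g + (- 1) * g1 by rewrite eg; ring.
  by apply: pD => //; apply: pM; apply: varsp; rewrite vars_fromE.
(* If [j = 0], then [g2] is a nonzero constant and [p] would contain 1. Otherwise stability lets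
   [g2] be cancelled modulo the colon by the predecessor of [x_j], which then lies in [p], against
   the choice of [j]. *)
exfalso; have [j0|j_gt0] := posnP j.
  apply: p1; rewrite ep /= mul1r; apply: supp_in_cancel g2_neq0 _ fg2 => // m m' m'g2.
  have -> : m' = 0%MM.
    apply/mnmP => l; rewrite mnm0E; apply/eqP; rewrite -leqn0 leqNgt.
    by apply/negP => /(g2lt _ _ m'g2); rewrite j0.
  by rewrite addm0.
have ltj1n : (j.-1 < n)%N by apply: leq_ltn_trans (leq_pred j) (ltn_ord j).
suff /pX pj1 : supp_in (colon_var A (Ordinal ltj1n)) f.
  by have := jmin (Ordinal ltj1n) (asboolT pj1); rewrite /= leqNgt prednK ?leqnn.
have hA1 := @colon_var_upset _ _ (Ordinal ltj1n) hA.
apply: (supp_in_cancel hA1 g2_neq0 _ (supp_inS (@sub_colon_var _ _ _) fg2)).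
move=> m m' m'g2; apply: colon_var_cancel => // l /(g2lt _ _ m'g2) ltlj.
have : (l <= Ordinal ltj1n)%N by rewrite /= -ltnS prednK.
by rewrite leq_eqVlt => /orP[/eqP/val_inj->//|]; apply: Ast.
Qed.

(** * Conditions (i) to (iii) in terms of exponents *)

Lemma nonzerodivisor_initial A (j : 'I_n) : upset A ->
  nonzerodivisor_quot (saturation
    (supp_in (A `|` involves [set l : 'I_n | (l < j)%N]))) 'X_j <->
  forall mu, (forall i : 'I_n, (i < j)%N -> mu i = 0%N) -> colon_var A j mu ->
    forall l : 'I_n, (j <= l)%N -> colon_var A l mu.
Proof.
move=> hA; set B := A `|` _.
have hB : upset B.
  move=> m m' le [Am|Vm]; first by left; apply: hA le Am.
  by right; apply: involves_upset le Vm.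
(* On monomials free of the variables before [x_j], [A] and [B] have the same colon by any variable
   from [x_j] on; for an earlier variable the colon of [B] is everything. *)
have BA (l : 'I_n) mu : (forall i : 'I_n, (i < j)%N -> mu i = 0%N) -> (j <= l)%N ->
    colon_var B l mu -> colon_var A l mu.
  move=> mu0 lejl [t [At|[i ltij]]]; first by exists t.
  rewrite mnmDE mu0 // mulmnE mnm1E; case: eqP => // eli.
  by move: ltij; rewrite /= -eli ltnNge lejl.
have AB l mu : colon_var A l mu -> colon_var B l mu.
  by move=> [t At]; exists t; left.
have Blt (l : 'I_n) mu : (l < j)%N -> colon_var B l mu.
  move=> ltlj; exists 1%N; right; exists l => //.
  by rewrite mulm1n mnmDE mnm1E eqxx addn1.
rewrite saturation_supp_in //; split.
  move=> /nonzerodivisor_supp_in h mu mu0 [t].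
  (* Powers of [x_j] are stripped off one at a time, each by one use of the nonzerodivisor
     property. *)
  elim: t mu mu0 => [|t IHt] mu mu0 At l lejl.
    by apply: sub_colon_var; rewrite mulm0n addm0 in At.
  apply: BA => //; apply: h => l'; have [/Blt//|lejl'] := ltnP l' j; apply: AB.
  apply: IHt => // [i ltij|].
    by rewrite mnmDE mu0 // mnm1E; case: eqP => // eji; move: ltij; rewrite eji ltnn.
  by rewrite -addmA -mulmS.
move=> h; apply/nonzerodivisor_supp_in => m hm l.
have [[i ltij mi]|nV] := pselect (involves [set l : 'I_n | (l < j)%N] m).
  by exists 0%N; right; exists i => //; rewrite mulm0n addm0.
have [/Blt//|lejl] := ltnP l j; apply: AB.
have m0 (i : 'I_n) : (i < j)%N -> m i = 0%N.
  move=> ltij; apply/eqP; rewrite -leqn0 leqNgt; apply/negP => mi.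
  by apply: nV; exists i.
apply: h => //; apply: (@colon_varK _ _ _ _ 1%N); rewrite mulm1n.
apply: BA => // i ltij.
by rewrite mnmDE m0 // mnm1E; case: eqP => // eji; move: ltij; rewrite eji ltnn.
Qed.

Lemma colon_inf_var A (i : 'I_n) : upset A ->
  colon_inf (supp_in A) (ideal_gen [set 'X_i]) = supp_in (colon_var A i).
Proof.
move=> hA; have hI := ideal_supp_in hA.
rewrite -(image_set1 (fun l => 'X_l) i).
apply/seteqP; split=> f; first move=> /(colon_infP _ _ hI)/(_ i erefl) ft.
  exact/supp_in_colon_var.
by move=> /(supp_in_colon_var _ _ hA) ft; apply/colon_infP => // _ ->.
Qed.

Lemma quasi_stableP A : upset A -> quasi_stable (supp_in A) <-> stable A.
Proof.
have eA : [set mu | supp_in A 'X_[mu]] = A.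
  by apply/seteqP; split=> m /supp_inX.
move=> hA; split=> [[H Hfin [_ + _]]|Ast].
  by rewrite eA; apply: pommaret_stable.
exists (pommaret_gens A); first exact: pommaret_gens_finite.
split; first by move=> mu [Amu _]; apply/supp_inX.
  by rewrite eA; apply: pommaret_gens_cover.
exact: pommaret_gens_trivIset.
Qed.

End PolynomialIdeals.

(** * The six conditions compared with stability *)

Unset Implicit Arguments.

Theorem proposition4p3 (k : fieldType) (n : nat) (hn : (0 < n)%N)
    (I : set {mpoly k[n]}) (D : int)
    (hI : monomial_ideal I) (hD : krull_dim_quot I D) :
  let s1 := quasi_stable I in
  let s2 :=
    nonzerodivisor_quot (saturation I) 'X_(Ordinal hn) /\
    (forall j : 'I_n, (1 <= j)%N -> j%:Z < D ->
       nonzerodivisor_quot (saturation (add_vars I j)) 'X_j) in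
  let s3 :=
    (forall i j : 'I_n, j = i.+1 :> nat -> (j.+1)%:Z <= D ->
       colon_inf I (ideal_gen [set 'X_i]) `<=`
       colon_inf I (ideal_gen [set 'X_j])) /\
    (forall j : 'I_n, D < (j.+1)%:Z ->
       exists2 kj : nat, (1 <= kj)%N & I ('X_j ^+ kj)) in
  let s4 :=
    forall j : 'I_n,
      colon_inf I (ideal_gen [set 'X_j]) = colon_inf I (vars_from j) in
  let s5 :=
    forall p : set {mpoly k[n]}, associated_prime I p ->
      exists j : 'I_n, p = vars_from j in
  let s6 :=
    forall (mu : 'X_{1..n}) (i : 'I_n), I 'X_[mu] -> (0 < mu i)%N ->
      (i.+1 < n)%N ->
      forall r : nat, (0 < r <= mu i)%N ->
      forall j : 'I_n, (i < j)%N ->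
      exists s : nat, I 'X_[(mu - U_(i) *+ r + U_(j) *+ s)%MM] in
  (I <> [set 0] -> [<-> s1; s2; s3; s4; s5; s6]) /\
  [<-> s1; s2; s3; s4; s6].
Proof.
move=> s1 s2 s3 s4 s5 s6; have [A hA eI] : exists2 A, upset A & I = supp_in A.
  by have [hA eI] := monomial_idealP hI; exists [set m | I 'X_[m]].
move: hD; clear hI; subst I => -[_ /chains_bounded_dim_bounded hD _].
have e1 : s1 <-> stable A by apply: quasi_stableP.
have e2 : s2 <-> stable A.
  (* With no variables added, the condition on the saturation of [I] becomes the case [j = 0] of the
     others. *)
  pose A_ (j : nat) := A `|` involves [set l : 'I_n | (l < j)%N].
  have A0 : A = A_ 0%N.
    apply/seteqP; split=> m; first by left.
    by case=> // -[].
  rewrite /s2 {1}A0; split=> [[h0 hj]|Ast].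
    apply: (stable_of_initial_conditions hA hD) => j hjD.
    apply/(nonzerodivisor_initial (k := k) j hA).
    have [j0|j_gt0] := posnP j.
      by have -> : j = Ordinal hn by apply: val_inj.
    case: hjD => [j0|ltjD]; first by rewrite j0 in j_gt0.
    by rewrite -ideal_gen_addX //; apply: hj.
  have hst (j l : 'I_n) : (j <= l)%N -> colon_var A j `<=` colon_var A l.
    by rewrite leq_eqVlt => /orP[/eqP/val_inj->//|]; apply: Ast.
  split=> [|j _ _].
    by apply/(nonzerodivisor_initial (Ordinal hn)) => // mu _ ? l /hst; apply.
  rewrite /add_vars ideal_gen_addX //.
  by apply/nonzerodivisor_initial => // mu _ ? l /hst; apply.
have e3 : s3 <-> stable A.
  rewrite /s3; split=> [[hchain hpow] i j|Ast].
    (* Condition (iii) compares neighbours only, so induction on [j - i] goes through the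
       predecessor of [j]; beyond [D] a power of [x_j] lies in the ideal. *)
    have [d] := ubnP (j - i)%N; elim: d j => // d IHd j ltd ltij m Aim.
    have [leDj|ltDj] := leP ((j.+1)%:Z) D; last first.
      have [t _] := hpow j ltDj; rewrite mpolyXn => /supp_inX At.
      by exists t; apply: hA At; exact: lem_addl.
    have ltj1n : (j.-1 < n)%N by apply: leq_ltn_trans (leq_pred j) (ltn_ord j).
    pose j1 := Ordinal ltj1n.
    have Aj1 : colon_var A j1 m.
      have [eij|neij] := eqVneq i j1; first by rewrite -eij.
      have nij : (i : nat) <> j.-1 by move=> e; case/eqP: neij; apply: val_inj.
      by apply: IHd Aim; rewrite /=; lia.
    have := hchain j1 j; rewrite !colon_inf_var // => /(_ _ leDj 'X_[m]).
    by move=> h; apply/supp_inX/h; [rewrite /=; lia|apply/supp_inX].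
  split=> [i j eji _|j ltDj].
    by rewrite !colon_inf_var //; apply: supp_inS; apply: Ast; rewrite eji.
  have [t At] : colon_var A j 0%MM.
    by apply: (colon_var_full hA hD (leqnn j) ltDj) => i; apply: Ast.
  exists t.+1 => //; rewrite mpolyXn; apply/supp_inX; apply: hA At.
  by apply/mnm_lepP => l; rewrite mnmDE mnm0E !mulmnE leq_mul.
have e4 : s4 <-> stable A.
  have hI := ideal_supp_in (k := k) hA.
  have colonP (f : {mpoly k[n]}) (j : 'I_n) : colon_inf (supp_in A) (vars_from j) f <->
      forall l : 'I_n, (j <= l)%N -> supp_in (colon_var A l) f.
    split=> [/(colon_infP _ _ hI) h l lejl|h].
      by apply/supp_in_colon_var => //; apply: h.
    by apply/(colon_infP _ _ hI) => l /h/(supp_in_colon_var _ _ hA).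
  rewrite /s4; split=> [h i j ltij m Am|Ast j].
    have : colon_inf (supp_in A) (vars_from i) 'X_[k, m].
      by rewrite -h colon_inf_var //; apply/supp_inX.
    by move=> /colonP/(_ j (ltnW ltij))/supp_inX.
  rewrite colon_inf_var //; apply/seteqP; split=> f.
    move=> fA; apply/colonP => l; rewrite leq_eqVlt => /orP[/eqP/val_inj<-//|ltjl].
    exact: supp_inS (Ast j l ltjl) _ fA.
  by move=> /colonP; apply.
have e6 : s6 <-> stable A.
  rewrite stableP // /s6.
  split=> h mu i Amu mui ltin r hr j ltij.
    by have [s /supp_inX] := h mu i ((supp_inX _ _).2 Amu) mui ltin r hr j ltij; exists s.
  move/supp_inX: Amu => Amu; have [s As] := h mu i Amu mui ltin r hr j ltij.
  by exists s; apply/supp_inX.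
(* For [I = 0] the associated prime 0 contains no variable, so (v) fails although the other
   conditions hold; (v) is compared for nonzero [I]. *)
split=> [I0|]; last by tfae; tauto.
have e5 : s5 <-> stable A.
  by split=> [|Ast p]; [exact: associated_prime_stable|exact: stable_associated_prime].
tfae; tauto.
Qed.
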